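(* Let $d\ge 1$ be an integer, and let $N=N(d)$ and $r=r(d,N)$ be constants as described in the context. Then there is a constant $C=C(d)>1$, depending only on $d$, such that for all $n\ge N$, all operator norms $\|\cdot\|$ on $M_d(\mathbb{C})$, and all $A_1,\dots,A_n\in M_d(\mathbb{C})$: $$\|A_n\cdots A_1\|\le C\left(\prod_{1\le i\le n}\|A_i\|\right)\max_{1\le\alpha\le\beta\le n}\left(\frac{\rho(A_\beta A_{\beta-1}\cdots A_\alpha)}{\prod_{\alpha\le i\le\beta}\|A_i\|}\right)^{1/r},$$ where the right-hand side is treated as zero if one of the $A_i$ is the zero matrix.
   Context: $\rho$ denotes spectral radius. An operator norm on $M_d(\mathbb{C})$ is one of the form $\|A\|=\sup_{v\in\mathbb{C}^d\setminus\{0\}}\|Av\|/\|v\|$ for some norm $\|\cdot\|$ on $\mathbb{C}^d$. The constants $N$ and $r$: $N=N(d)$ is a positive integer with $N\le\prod_{i=1}^d\binom{d}{i}$ and $r=r(d,N)>0$ satisfies $r\le(Nd+1)^{Nd^2+2}$, with $N$ depending only on $d$ and $r$ only on $d,N$, and they have the following property (such constants exist by a theorem of the paper): for every local field $k$ and every submultiplicative norm $\|\cdot\|$ on $M_d(k)$ there is a constant $C'=C'(d,\|\cdot\|)>1$ such that for all $n\ge N$ and $A_1,\dots,A_n\in M_d(k)$, $\|A_n\cdots A_1\|\le C'\left(\prod_{1\le i\le n}\|A_i\|\right)\max_{1\le\alpha\le\beta\le n}\left(\rho(A_\beta\cdots A_\alpha)/\prod_{\alpha\le i\le\beta}\|A_i\|\right)^{1/r}$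 (right-hand side treated as zero if some $A_i=0$). Here a local field is a field with an absolute value inducing a non-discrete locally compact topology, and spectral radii are computed using the unique extension of the absolute value to the algebraic closure. *)

(* Defs.v *)
From HB Require Import structures.
From mathcomp Require Import all_boot all_order all_algebra.
From mathcomp Require Import all_classical all_reals all_analysis.
From mathcomp Require Import complex.

Set Implicit Arguments.
Unset Strict Implicit.
Unset Printing Implicit Defensive.

Import Order.TTheory GRing.Theory Num.Theory.

Local Open Scope classical_set_scope.
Local Open Scope ring_scope.

Record absvalue (R : realType) (k : fieldType) := AbsValue {
  absv :> k -> R;
  absv_ge0 : forall x, 0 <= absv x;
  absv_eq0 : forall x, absv x = 0 <-> x = 0;
  absvM : forall x y, absv (x * y) = absv x * absv y;
  absvD : forall x y, absv (x + y) <= absv x + absv y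
}.

(* Alias of k carrying the metric |x - y| given by v. *)
Definition absv_space (R : realType) (k : fieldType) (v : absvalue R k) : Type :=
  k.

Section AbsvMetric.
Context (R : realType) (k : fieldType) (v : absvalue R k).

Definition absv_dist (x y : absv_space v) : R := v ((x : k) - (y : k)).

Fact absv_distxx x : absv_dist x x = 0.
Proof. by apply/absv_eq0; rewrite subrr. Qed.

Fact absv_dist_positivity x y : absv_dist x y = 0 -> x = y.
Proof. by move/absv_eq0/subr0_eq. Qed.

Fact absvN x : v (- x) = v x.
Proof.
have v1 : v 1 = 1.
  have /eqP := absvM v 1 1; rewrite mulr1 eq_sym -subr_eq0 -{3}[v 1]mulr1.
  rewrite -mulrBr mulf_eq0 subr_eq0 => /orP[/eqP/absv_eq0/eqP|/eqP//].
  by rewrite oner_eq0.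
have vN1 : v (-1) = 1.
  have /eqP := absvM v (-1) (-1).
  rewrite mulrNN mulr1 v1 eq_sym -expr2 sqrf_eq1 => /orP[/eqP//|/eqP h].
  by have := absv_ge0 v (-1); rewrite h oppr_ge0 ler10.
by rewrite -mulN1r absvM vN1 mul1r.
Qed.

Fact absv_dist_sym x y : absv_dist x y = absv_dist y x.
Proof. by rewrite /absv_dist -absvN opprB. Qed.

Fact absv_dist_triangle y x z : absv_dist x z <= absv_dist x y + absv_dist y z.
Proof.
rewrite /absv_dist; have -> : (x : k) - z = (x - y) + (y - z) by rewrite subrKA.
exact: absvD.
Qed.

HB.instance Definition _ := Choice.copy (absv_space v) k.
HB.instance Definition _ := isMetric.Build R (absv_space v)
  absv_distxx absv_dist_positivity absv_dist_sym absv_dist_triangle.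
End AbsvMetric.

Definition local_field (R : realType) (k : fieldType) (v : absvalue R k) : Prop :=
  locally_compact [set: absv_space v] /\
  ~ (forall U : set (absv_space v), open U).

Definition algebraic_closure (k : fieldType) (K : closedFieldType)
    (iota : {rmorphism k -> K}) : Prop :=
  forall x : K, algebraicOver iota x.

Definition is_norm (R : realType) (k : fieldType) (v : absvalue R k)
    (V : lmodType k) (nrm : V -> R) : Prop :=
  [/\ forall x, 0 <= nrm x,
      forall x, nrm x = 0 -> x = 0,
      forall (a : k) x, nrm (a *: x) = v a * nrm x &
      forall x y, nrm (x + y) <= nrm x + nrm y].

Definition submult_norm (R : realType) (k : fieldType) (v : absvalue R k)
    (d : nat) (nrm : 'M[k]_d -> R) : Prop :=
  is_norm v nrm /\ forall A B, nrm (A *m B) <= nrm A * nrm B.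

Definition operator_norm (R : realType) (k : fieldType) (v : absvalue R k)
    (d : nat) (nrm : 'M[k]_d -> R) : Prop :=
  exists vnrm : 'cV[k]_d -> R, is_norm v vnrm /\
    forall A, nrm A = sup [set vnrm (A *m x) / vnrm x | x in [set x | x != 0]].

(* K is meant to contain all roots of the characteristic polynomial of A. *)
Definition spectral_radius (R : realType) (K : fieldType) (d : nat)
    (v : absvalue R K) (A : 'M[K]_d) : R :=
  sup [set v l | l in [set l | eigenvalue A l]].

(* A_b A_(b-1) ... A_a *)
Definition rprod (k : fieldType) (d : nat) (A : nat -> 'M[k]_d) (a b : nat) :
    'M[k]_d :=
  \big[*%R/1]_(i <- rev (index_iota a b.+1)) A i.

(* Both maxima range over nonnegative numbers, hence the default value 0. *)
Definition spectral_bound (R : realType) (k : fieldType) (d : nat)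
    (nrm rho : 'M[k]_d -> R) (r : R) (n : nat) (A : nat -> 'M[k]_d) : R :=
  if has (fun i => A i == 0) (index_iota 1 n.+1) then 0 else
  (\prod_(1 <= i < n.+1) nrm (A i)) *
  \big[Num.max/0]_(1 <= a < n.+1) \big[Num.max/0]_(a <= b < n.+1)
    (rho (rprod A a b) / \prod_(a <= i < b.+1) nrm (A i)) `^ r^-1.

(* The extension w of v to the algebraic closure K is unique, since a local
   field is complete; quantifying over all (K, w) avoids constructing it. *)
Definition local_spectral_inequality (R : realType) (d N : nat) (r : R) : Prop :=
  forall (k : fieldType) (v : absvalue R k), local_field v ->
  forall (K : closedFieldType) (iota : {rmorphism k -> K}) (w : absvalue R K),
  algebraic_closure iota -> (forall x, w (iota x) = v x) ->
  forall nrm : 'M[k]_d -> R, submult_norm v nrm ->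
  exists C' : R, 1 < C' /\
  forall (n : nat) (A : nat -> 'M[k]_d), (N <= n)%N ->
  nrm (rprod A 1 n) <= C' *
    spectral_bound nrm (fun B => spectral_radius w (map_mx iota B)) r n A.

Definition admissible_constants (R : realType) (d N : nat) (r : R) : Prop :=
  [/\ (0 < N)%N,
      (N <= \prod_(1 <= i < d.+1) 'C(d, i))%N,
      0 < r,
      r <= ((N * d + 1) ^ (N * d ^ 2 + 2))%N%:R &
      local_spectral_inequality d N r].

Section ComplexAbsv.
Context (R : realType).
Import ComplexField.Normc.

Fact normc_eq0 (z : R[i]) : normc z = 0 <-> z = 0.
Proof. by split=> [/eq0_normc//|->]; rewrite normc0. Qed.

Fact normc_ge0 (z : R[i]) : 0 <= normc z.
Proof. by case: z => a b; exact: sqrtr_ge0. Qed.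

Definition complex_absv : absvalue R R[i] :=
  AbsValue normc_ge0 normc_eq0 (@normcM R) (@le_normcD R).
End ComplexAbsv.

(* Main.v *)
Require Import Defs.
From mathcomp Require Import all_boot all_order all_algebra all_fingroup.
From mathcomp Require Import all_classical all_reals all_analysis.
From mathcomp Require Import complex zify.
Import Order.TTheory GRing.Theory Num.Theory.
Local Open Scope ring_scope.
Import numFieldNormedType.Exports.

Set Implicit Arguments.
Unset Strict Implicit.
Unset Printing Implicit Defensive.

(** The inequality is known for each submultiplicative norm over each local
field, with a constant that may depend on the norm.  To make the constant
uniform over all operator norms on complex matrices, fix one submultiplicative
norm, here the sum S of the absolute values of the entries, and compare every
operator norm with it up to conjugation.

By a version of Auerbach's theorem ([almost_auerbach]), any norm on C^d admits
a basis T of vectors of norm at most 1 in which the coordinates of x are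
bounded by twice the norm of x.  Hence ([operator_norm_conj]) the operator norm
of A and S(T^-1 A T) differ by at most the factors 2 and 2 d^2, which depend on
d only.  Conjugation by T commutes with products and preserves spectral radii,
so the inequality for S, applied to the matrices T^-1 A_i T, gives the one for
the operator norm ([spectral_max_equiv]), up to a constant which grows
exponentially with the number n of factors.

That loss is harmless because only n = N has to be treated in this way: for
larger n the factors A_i with i > N are split off by submultiplicativity, and
the maximum over 1 <= a <= b <= N is at most the maximum over
1 <= a <= b <= n. *)

(** * Absolute values *)

Section AbsoluteValue.
Context {R : realType} {k : fieldType} (v : absvalue R k).

Lemma absv0 : v 0 = 0.
Proof. exact/absv_eq0. Qed.

Lemma absv_gt0 x : x != 0 -> 0 < v x.
Proof.
by move=> x0; rewrite lt0r absv_ge0 andbT; apply: contra x0 => /eqP/absv_eq0->.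
Qed.

Lemma absv1 : v 1 = 1.
Proof.
have v1 : v 1 != 0 by rewrite gt_eqF// absv_gt0// oner_eq0.
by apply: (mulfI v1); rewrite -absvM !mulr1.
Qed.

Lemma absvV x : v x^-1 = (v x)^-1.
Proof.
have [->|x0] := eqVneq x 0; first by rewrite invr0 absv0 invr0.
by apply/eqP; rewrite -[eqbRHS]mul1r eq_sym -(absv1) -(divff x0) absvM mulrC
  mulKf// gt_eqF// absv_gt0.
Qed.

Lemma absv_sum I (s : seq I) (P : pred I) (F : I -> k) :
  v (\sum_(i <- s | P i) F i) <= \sum_(i <- s | P i) v (F i).
Proof.
elim/big_ind2 : _ => [|x a y b xa yb|//]; first by rewrite absv0.
exact: le_trans (absvD v _ _) (lerD xa yb).
Qed.

Lemma absv_prod I (s : seq I) (P : pred I) (F : I -> k) :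
  v (\prod_(i <- s | P i) F i) = \prod_(i <- s | P i) v (F i).
Proof. by elim/big_rec2 : _ => [|i a b _ <-]; rewrite ?absv1 ?absvM. Qed.

End AbsoluteValue.

(** * The complex numbers as a local field *)

Section ComplexLocal.
Context {R : realType}.
Local Notation cabs := (complex_absv R).

Lemma cabs_real (a : R) : cabs a%:C%C = `|a|.
Proof. by rewrite /= expr0n addr0 sqrtr_sqr. Qed.

Lemma cabs_im (a : R) : cabs (0 +i* a)%C = `|a|.
Proof. by rewrite /= expr0n add0r sqrtr_sqr. Qed.

Lemma cabs_le (a b : R) : cabs (a +i* b)%C <= `|a| + `|b|.
Proof.
rewrite -cabs_real -cabs_im; apply: le_trans (absvD _ _ _).
by rewrite le_eqVlt; apply/orP; left; apply/eqP; congr (cabs _); simpc.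
Qed.

Lemma le_cabs (a b : R) : `|a| <= cabs (a +i* b)%C /\ `|b| <= cabs (a +i* b)%C.
Proof.
by split; rewrite -sqrtr_sqr /= ler_wsqrtr// ?lerDl ?lerDr sqr_ge0.
Qed.

Local Notation CC := (absv_space cabs).

Let cpx (p : R * R) : CC := (p.1 +i* p.2)%C.

Lemma cpx_continuous : continuous cpx.
Proof.
move=> p; apply/cvg_ballP => e e0.
have e20 : 0 < e / 2 by rewrite divr_gt0.
exists (ball p.1 (e / 2), ball p.2 (e / 2)) => /=.
  by split; exact: nbhsx_ballx.
case=> a b [/= Ha Hb]; rewrite ballEmdist.
change (cabs ((p.1 - a) +i* (p.2 - b))%C < e).
apply: le_lt_trans (cabs_le _ _) _; rewrite (splitr e).
by apply: ltrD; [move: Ha|move: Hb]; rewrite -ball_normE.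
Qed.

(** The closed square of half-side 1 around z is a compact neighbourhood of z,
being the image of a product of two segments; and the open ball of radius e
around 0 contains the real number e / 2, so that 0 is not isolated. *)
Lemma local_field_complex : local_field cabs.
Proof.
split; last first.
  move=> /(_ [set 0]%classic); rewrite openE => /(_ 0 erefl).
  move=> /nbhs_ballP[e /= e0 /(_ (e / 2)%:C%C)].
  have e20 : 0 < e / 2 by rewrite divr_gt0.
  have inball : ball (0 : CC) e ((e / 2)%:C%C : CC).
    rewrite ballEmdist; change (cabs (0 - (e / 2)%:C%C) < e).
    rewrite sub0r absvN cabs_real gtr0_norm//.
    by rewrite ltr_pdivrMr// mulr_natr mulr2n ltrDl.
  by move=> /(_ inball) [] /eqP; rewrite gt_eqF.
case=> x y _; rewrite withinET.
pose box := (`[x - 1, x + 1] `*` `[y - 1, y + 1])%classic.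
have cbox : compact (cpx @` box)%classic.
  apply: continuous_compact.
    by apply: continuous_subspaceT => z; exact: cpx_continuous.
  by apply: compact_setX; exact: segment_compact.
exists (cpx @` box)%classic; last first.
  by split => //; apply: compact_closed => //; exact: metric_hausdorff.
apply/nbhs_ballP; exists 1 => //= -[a b]; rewrite ballEmdist.
change (cabs ((x - a) +i* (y - b))%C < 1 -> (cpx @` box)%classic (a +i* b)%C).
move=> /ltW ab1; have [xa yb] := le_cabs (x - a) (y - b).
exists (a, b) => //; split; rewrite /= in_itv /= -ler_distlC.
  exact: le_trans xa ab1.
exact: le_trans yb ab1.
Qed.

End ComplexLocal.

(** * Norms on finite-dimensional complex spaces *)

Section IsNorm.
Context {R : realType} {k : fieldType} {v : absvalue R k} {V : lmodType k}.
Context {nrm : V -> R} (nrmP : is_norm v nrm).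

Lemma is_norm0 : nrm 0 = 0.
Proof. by case: nrmP => _ _ nZ _; rewrite -(scale0r 0) nZ absv0 mul0r. Qed.

Lemma is_norm_gt0 x : x != 0 -> 0 < nrm x.
Proof.
case: nrmP => n0 nd _ _ x0; rewrite lt0r n0 andbT.
by apply: contra x0 => /eqP/nd->.
Qed.

Lemma is_norm_sum I (s : seq I) (P : pred I) (F : I -> V) :
  nrm (\sum_(i <- s | P i) F i) <= \sum_(i <- s | P i) nrm (F i).
Proof.
case: nrmP => _ _ _ nD.
elim/big_ind2 : _ => [|x a y b xa yb|//]; first by rewrite is_norm0.
exact: le_trans (nD _ _) (lerD xa yb).
Qed.

Lemma is_norm_dist x y : `|nrm x - nrm y| <= nrm (x - y).
Proof.
case: nrmP => _ _ nZ nD; rewrite ler_distl lerBlDl; apply/andP; split.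
  rewrite -[nrm (x - y)]mul1r -(absv1 v) -(absvN v) -nZ scaleN1r opprB.
  by apply: le_trans (nD _ _); rewrite subrK.
by rewrite addrC; apply: le_trans (nD _ _); rewrite subrK.
Qed.

End IsNorm.

Section CoordBound.
Context {R : realType}.
Local Notation cabs := (complex_absv R).

Lemma is_norm_mulmx_le d p (vn : 'cV[R[i]]_d -> R) (T : 'M[R[i]]_(d, p))
    (x : 'cV[R[i]]_p) : is_norm cabs vn ->
  vn (T *m x) <= \sum_j cabs (x j 0) * vn (col j T).
Proof.
move=> vnP; have [_ _ nZ _] := vnP.
have -> : T *m x = \sum_j x j 0 *: col j T.
  apply/matrixP => i j; rewrite ord1 !mxE summxE.
  by apply: eq_bigr => l _; rewrite !mxE mulrC.
apply: le_trans (is_norm_sum vnP _ _ _) _.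
by apply: ler_sum => j _; rewrite nZ.
Qed.

Lemma ler_mx_norm_entry m n (u : 'M[R]_(m, n)) i j : `|u i j| <= `|u|.
Proof.
by rewrite [leRHS]/Num.norm /= mx_normrE; exact: (le_bigmax _ _ (i, j)).
Qed.

Lemma lipschitz_continuous (V : normedModType R) (f : V -> R) L :
  (forall x y, `|f x - f y| <= L * `|x - y|) -> continuous f.
Proof.
move=> fL x; apply/cvgrPdist_lt => e e0.
have L1 : 0 < `|L| + 1 by rewrite ltr_wpDl.
apply/nbhs_normP; exists (e / (`|L| + 1)); first by rewrite /= divr_gt0.
move=> y; rewrite /= ltr_pdivlMr// => xy; apply: le_lt_trans (fL _ _) _.
apply: le_lt_trans xy; rewrite mulrC ler_wpM2l//.
by apply: le_trans (ler_norm _) _; rewrite lerDl.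
Qed.

(** One half of the equivalence of norms in finite dimension.  Seen as a
function on R^(2d), the norm is Lipschitz, hence attains a minimum on the
compact unit sphere of the sup norm; this minimum is positive, and homogeneity
concludes. *)
Lemma norm_coord_bound d (vn : 'cV[R[i]]_d -> R) : is_norm cabs vn ->
  exists2 m, 0 < m & forall (x : 'cV_d) i, cabs (x i 0) <= m * vn x.
Proof.
case: d vn => [|d] vn vnP; first by exists 1 => // x [].
have [vn_ge0 _ vnZ _] := vnP.
pose toC (u : 'rV[R]_(d.+1 + d.+1)) : 'cV[R[i]]_d.+1 :=
  \col_j (u 0 (lshift _ j) +i* u 0 (rshift _ j))%C.
have toCB u w : toC u - toC w = toC (u - w).
  by apply/matrixP => i j; rewrite !mxE; simpc.
have toCZ a u : toC (a *: u) = a%:C%C *: toC u.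
  by apply/matrixP => i j; rewrite !mxE; simpc.
pose L := \sum_j vn (col j 1%:M).
have L_ge0 : 0 <= L by apply: sumr_ge0 => j _; exact: vn_ge0.
have vn_toC u : vn (toC u) <= (2 * `|u|) * L.
  rewrite -[toC u]mul1mx; apply: le_trans (is_norm_mulmx_le _ _ vnP) _.
  rewrite mulr_sumr; apply: ler_sum => j _.
  apply: ler_wpM2r; first exact: vn_ge0.
  rewrite mxE; apply: le_trans (cabs_le _ _) _.
  by rewrite mulr_natl mulr2n; apply: lerD; exact: ler_mx_norm_entry.
pose f : 'rV[R]_(d.+1 + d.+1) -> R := vn \o toC.
have fL u w : `|f u - f w| <= 2 * L * `|u - w|.
  apply: le_trans (is_norm_dist vnP _ _) _; rewrite toCB mulrAC.
  exact: vn_toC.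
have cont := lipschitz_continuous fL.
pose S := [set u : 'rV[R]_(d.+1 + d.+1) | `|u| = 1]%classic.
have normalize (u : 'rV[R]_(d.+1 + d.+1)) : u != 0 -> S (`|u|^-1 *: u).
  by move=> u0; rewrite /S /= normrZ normfV normr_id mulVf// normr_eq0.
have [c] : exists2 c, c \in S & forall t, t \in S -> f c <= f t.
  apply: EVT_min_rV.
  - exists (`|const_mx 1 : 'rV[R]_(d.+1 + d.+1)|^-1 *: const_mx 1).
    apply: normalize; apply/eqP => /matrixP/(_ 0 (lshift _ ord0)).
    by rewrite !mxE; apply/eqP/oner_neq0.
  - apply: bounded_closed_compact.
      by exists 1; split=> // x x1 u /= ->; exact: ltW.
    rewrite (_ : S = (Num.norm @^-1` [set 1])%classic)//.
    by apply: closed_comp => [u _|]; [exact: norm_continuous|exact: closed_eq].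
  - exact: continuous_subspaceT.
rewrite inE => Sc cmin.
have c_gt0 : 0 < vn (toC c).
  apply: (is_norm_gt0 vnP); apply/eqP => c0.
  suff c00 : c = 0.
    by move: Sc; rewrite /S /= c00 normr0 => /esym/eqP; rewrite oner_eq0.
  apply/matrixP => i j; rewrite ord1 mxE.
  case: (split_ordP j) => l ->.
    by move/matrixP: c0 => /(_ l 0); rewrite !mxE => -[].
  by move/matrixP: c0 => /(_ l 0); rewrite !mxE => -[].
exists (2 / vn (toC c)); first by rewrite divr_gt0.
move=> x i.
pose u := row_mx (\row_j complex.Re (x j 0)) (\row_j complex.Im (x j 0)).
have ux : toC u = x.
  apply/matrixP => l j; rewrite ord1 mxE row_mxEl row_mxEr !mxE.
  by case: (x l 0).
have xu : cabs (x i 0) <= 2 * `|u|.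
  rewrite -ux mxE; apply: le_trans (cabs_le _ _) _.
  by rewrite mulr_natl mulr2n; apply: lerD; exact: ler_mx_norm_entry.
apply: le_trans xu _; rewrite -mulrA ler_wpM2l// mulrC ler_pdivlMr//.
have [->|u0] := eqVneq u 0; first by rewrite normr0 mul0r; exact: vn_ge0.
have := cmin _ (mem_set (normalize _ u0)).
rewrite /f /= toCZ vnZ cabs_real ux normfV normr_id ler_pdivlMl ?normr_gt0//.
Qed.

End CoordBound.

(** * Nearly Auerbach bases *)

Definition replace_col (k : Type) d (M : 'M[k]_d) i (x : 'cV[k]_d) : 'M[k]_d :=
  \matrix_(p, q) if q == i then x p 0 else M p q.

Lemma col_replace_col (k : Type) d (M : 'M[k]_d) i x j :
  col j (replace_col M i x) = if j == i then x else col j M.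
Proof.
by apply/matrixP => p q; rewrite ord1 !mxE; case: eqP => //; rewrite mxE.
Qed.

(** Cramer's rule. *)
Lemma det_replace_col (k : comPzRingType) d (M : 'M[k]_d) i x :
  \det (replace_col M i x) = (\adj M *m x) i 0.
Proof.
rewrite (expand_det_col _ i) mxE; apply: eq_bigr => p _.
rewrite mulrC !mxE eqxx; congr (_ * _ * _); congr (\det _).
by apply/matrixP => a b; rewrite !mxE eq_sym (negbTE (neq_lift _ _)).
Qed.

Lemma absv_det_le (R : realType) (k : fieldType) (v : absvalue R k) d
    (M : 'M[k]_d) (m : R) :
  (forall i j, v (M i j) <= m) ->
  v (\det M) <= \sum_(s : 'S_d) \prod_(i < d) m.
Proof.
move=> Mm; apply: le_trans (absv_sum _ _ _ _) _; apply: ler_sum => s _.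
have -> : v ((-1) ^+ s * \prod_i M i (s i)) = v (\prod_i M i (s i)).
  by case: (s : bool); rewrite ?expr1 ?mulN1r ?absvN// expr0 mul1r.
by rewrite absv_prod; apply: ler_prod => i _; rewrite absv_ge0 Mm.
Qed.

Section Auerbach.
Context {R : realType}.
Local Notation cabs := (complex_absv R).

(** Take for the columns of T vectors of the unit ball whose determinant is, in
absolute value, more than half of the supremum over all such families; this
supremum is finite by [norm_coord_bound].  By Cramer's rule, the i-th
coordinate of x in this basis is the quotient by det T of the determinant
obtained when x replaces the i-th column, and this quotient is at most 2 when x
is in the unit ball.  A maximal determinant would improve 2 to 1, but
near-maximality avoids proving that the maximum is attained. *)
Lemma almost_auerbach d (vn : 'cV[R[i]]_d -> R) : is_norm cabs vn ->
  exists T : 'M[R[i]]_d, [/\ T \in unitmx, forall j, vn (col j T) <= 1 &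
    forall x i, cabs ((invmx T *m x) i 0) <= 2 * vn x].
Proof.
move=> vnP; have [vn_ge0 _ vnZ _] := vnP.
have [m m_gt0 vn_m] := norm_coord_bound vnP.
pose E :=
  [set cabs (\det M) | M in [set M | forall j, vn (col j M) <= 1]]%classic.
have ubE : has_ubound E.
  exists (\sum_(s : 'S_d) \prod_(i < d) m) => _ [M /= M1 <-].
  apply: (absv_det_le (v := cabs)) => i j.
  have -> : M i j = col j M i 0 by rewrite mxE.
  by apply: le_trans (vn_m _ _) _; rewrite ger_pMr.
have [M0 M01 M0_gt0] : exists2 M : 'M[R[i]]_d, (forall j, vn (col j M) <= 1)
    & 0 < cabs (\det M).
  (* A small multiple of the identity has its columns in the unit ball. *)
  pose c := 1 + \sum_j vn (col j 1%:M).
  have c_gt0 : 0 < c by rewrite ltr_wpDr// sumr_ge0.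
  exists (c^-1%:C%C)%:M => [j|]; last first.
    rewrite absv_gt0// det_scalar expf_neq0//.
    by rewrite (inj_eq (@complexI _)) invr_eq0 gt_eqF.
  rewrite -scalemx1 linearZ /= vnZ cabs_real gtr0_norm ?invr_gt0//.
  rewrite ler_pdivrMl// mulr1 /c (bigD1 j)//= addrCA lerDl.
  by rewrite addr_ge0// sumr_ge0.
have supE : has_sup E by split => //; exists (cabs (\det M0)), M0.
have sup_gt0 : 0 < sup E.
  by apply: lt_le_trans M0_gt0 _; apply: ub_le_sup => //; exists M0.
have [_ [T /= T1 <-]] := sup_adherent (divr_gt0 sup_gt0 (ltr0Sn _ 1)) supE.
rewrite {1}[sup E]splitr addrK ltr_pdivrMr// => supT.
have detT_gt0 : 0 < cabs (\det T).
  by rewrite -(pmulr_lgt0 _ (ltr0Sn R 1)); apply: lt_trans supT.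
have Tu : T \in unitmx.
  rewrite unitmxE unitfE; apply/eqP => detT0.
  by move: detT_gt0; rewrite detT0 (absv0 cabs) ltxx.
exists T; split => // x i.
change (cabs ((invmx T *m x) i 0) <= 2 * vn x).
have [->|x0] := eqVneq x 0.
  by rewrite mulmx0 mxE (absv0 cabs) (is_norm0 vnP) mulr0.
have vx_gt0 := is_norm_gt0 vnP x0.
pose a := (vn x)^-1.
have : cabs (\det (replace_col T i (a%:C%C *: x))) <= sup E.
  apply: ub_le_sup => //; exists (replace_col T i (a%:C%C *: x)) => //= j.
  rewrite col_replace_col; case: eqP => // _.
  by rewrite vnZ cabs_real gtr0_norm ?invr_gt0// mulVf// gt_eqF.
have scaleE (b : R[i]) (y : 'cV[R[i]]_d) : (b *: y) i 0 = b * y i 0.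
  by rewrite mxE.
rewrite det_replace_col -scalemxAr scaleE absvM cabs_real gtr0_norm ?invr_gt0//.
rewrite ler_pdivrMl// /invmx Tu -scalemxAl scaleE absvM absvV => adj_le.
rewrite ler_pdivrMl//; apply: le_trans adj_le _.
by rewrite mulrA [leRHS]mulrC ler_pM2l// ltW.
Qed.

End Auerbach.

(** * The sum of the absolute values of the entries *)

Section EntryNorm.
Context {R : realType} {k : fieldType} (v : absvalue R k).

Definition entry_norm d (A : 'M[k]_d) : R := \sum_i \sum_j v (A i j).

Lemma entry_le d (A : 'M[k]_d) i j : v (A i j) <= entry_norm A.
Proof.
rewrite /entry_norm (bigD1 i)//= (bigD1 j)//= -addrA lerDl.
by rewrite addr_ge0// sumr_ge0// => ? _; rewrite ?sumr_ge0// => *;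
  exact: absv_ge0.
Qed.

Lemma entry_norm_submult d : submult_norm v (@entry_norm d).
Proof.
split; first split.
- by move=> A; do 2!apply: sumr_ge0 => ? _; exact: absv_ge0.
- move=> A A0; apply/matrixP => i j; rewrite mxE; apply/(absv_eq0 v)/eqP.
  by rewrite eq_le absv_ge0 andbT -A0 entry_le.
- move=> a A; rewrite /entry_norm mulr_sumr; apply: eq_bigr => i _.
  by rewrite mulr_sumr; apply: eq_bigr => j _; rewrite mxE absvM.
- move=> A B; rewrite /entry_norm -big_split; apply: ler_sum => i _ /=.
  by rewrite -big_split; apply: ler_sum => j _; rewrite mxE; exact: absvD.
move=> A B; rewrite /entry_norm mulr_suml; apply: ler_sum => i _.
have Bl (l : 'I_d) : \sum_j v (B l j) <= \sum_i0 \sum_j v (B i0 j).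
  rewrite [leRHS](bigD1 l)//= lerDl.
  by do 2!apply: sumr_ge0 => ? _; exact: absv_ge0.
rewrite mulr_suml.
apply: (@le_trans _ _ (\sum_j \sum_l v (A i l) * v (B l j))).
  apply: ler_sum => j _; rewrite mxE; apply: le_trans (absv_sum _ _ _ _) _.
  by apply: ler_sum => l _; rewrite absvM.
rewrite exchange_big /=; apply: ler_sum => l _; rewrite -mulr_sumr.
by apply: ler_wpM2l; [exact: absv_ge0|exact: Bl].
Qed.

End EntryNorm.

(** * Products and spectral radii under conjugation *)

Section Rprod.
Context {k : fieldType} {d : nat}.
Implicit Types (A : nat -> 'M[k]_d).

Lemma rprod_cat A a b c : (a <= b.+1)%N -> (b <= c)%N ->
  rprod A a c = rprod A b.+1 c *m rprod A a b.
Proof.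
move=> ab bc; rewrite /rprod.
have -> : index_iota a c.+1 = index_iota a b.+1 ++ index_iota b.+1 c.+1.
  rewrite /index_iota.
  have -> : (c.+1 - a = (b.+1 - a) + (c.+1 - b.+1))%N by lia.
  by rewrite iotaD subnKC.
by rewrite rev_cat big_cat.
Qed.

Lemma rprod_eq0 A a b i : (a <= i <= b)%N -> A i = 0 -> rprod A a b = 0.
Proof.
move=> /andP[ai ib] Ai0; rewrite (@rprod_cat _ _ i)// ?leqW//.
suff -> : rprod A a i = 0 by rewrite mulmx0.
rewrite /rprod /index_iota subSn// -addn1 iotaD rev_cat subnKC//= big_cons Ai0.
exact: mul0mx.
Qed.

Lemma rprod_conj A (T : 'M[k]_d) a b : T \in unitmx ->
  rprod (fun i => invmx T *m A i *m T) a b = invmx T *m rprod A a b *m T.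
Proof.
move=> Tu; rewrite /rprod.
rewrite (big_morph (fun B : 'M[k]_d => invmx T *m B *m T)
  (id1 := 1) (op1 := *%R))//.
  by move=> B C; rewrite -[RHS]/(_ *m _) -[B * C]/(B *m C) !mulmxA mulmxK.
by rewrite mulmx1 mulVmx.
Qed.

End Rprod.

(** A set without a supremum has supremum 0 by convention. *)
Lemma sup_ge0 (R : realType) (E : set R) :
  (forall x, E x -> 0 <= x) -> 0 <= sup E.
Proof.
move=> E_ge0; have [supE|/sup_out->//] := pselect (has_sup E).
case: supE => -[x Ex] ubE.
exact: le_trans (E_ge0 _ Ex) (ub_le_sup ubE Ex).
Qed.

Section SpectralRadius.
Context {R : realType} {k : fieldType} (v : absvalue R k) {d : nat}.

Lemma spectral_radius_ge0 (A : 'M[k]_d) : 0 <= spectral_radius v A.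
Proof.
apply: sup_ge0 => _ [l _ <-]; exact: absv_ge0.
Qed.

(** A row eigenvector u of the conjugate gives the row eigenvector u T^-1 of
A, for the same eigenvalue, and conversely. *)
Lemma spectral_radius_conj (A T : 'M[k]_d) : T \in unitmx ->
  spectral_radius v (invmx T *m A *m T) = spectral_radius v A.
Proof.
have sub (B S : 'M[k]_d) l : S \in unitmx -> eigenvalue (invmx S *m B *m S) l ->
    eigenvalue B l.
  move=> Su /eigenvalueP[u uB u0]; apply/eigenvalueP.
  exists (u *m invmx S); last first.
    apply: contra u0 => /eqP uS; apply/eqP.
    by rewrite -(mulmxKV Su u) uS mul0mx.
  by rewrite scalemxAl -uB !mulmxA mulmxK.
move=> Tu; rewrite /spectral_radius; congr sup.
apply/seteqP; split=> _ [l /= ll <-].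
  by exists l => //; exact: sub ll.
exists l => //=; apply: (sub _ (invmx T)); first by rewrite unitmx_inv.
by rewrite invmxK !mulmxA mulmxV// mul1mx mulmxK.
Qed.

End SpectralRadius.

(** * Operator norms *)

Section OperatorNorm.
Context {R : realType} {d : nat} (d_gt0 : (0 < d)%N).
Local Notation cabs := (complex_absv R).

Section OneNorm.
Context (vn : 'cV[R[i]]_d -> R) (nrm : 'M[R[i]]_d -> R).
Context (vnP : is_norm cabs vn).
Context (nrmE : forall A,
  nrm A = sup [set vn (A *m x) / vn x | x in [set x | x != 0]]%classic).

(** The supremum defining the operator norm is taken over a bounded set, by
[norm_coord_bound]. *)
Lemma operator_norm_apply A x : vn (A *m x) <= nrm A * vn x.
Proof.
have [vn_ge0 _ _ _] := vnP.
have [->|x0] := eqVneq x 0; first by rewrite mulmx0 (is_norm0 vnP) mulr0.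
have [m m_gt0 vn_m] := norm_coord_bound vnP.
rewrite -ler_pdivrMr ?(is_norm_gt0 vnP)// nrmE.
apply: ub_le_sup; last by exists x.
exists (\sum_j m * vn (col j A)) => _ [y /= y0 <-].
rewrite ler_pdivrMr ?(is_norm_gt0 vnP)//.
apply: le_trans (is_norm_mulmx_le _ _ vnP) _; rewrite mulr_suml.
by apply: ler_sum => j _; rewrite mulrAC; apply: ler_wpM2r.
Qed.

(** The positivity of d makes the supremum run over a nonempty set. *)
Lemma operator_norm_least A c :
  (forall x, vn (A *m x) <= c * vn x) -> nrm A <= c.
Proof.
move=> Ac; rewrite nrmE; apply: ge_sup; last first.
  by move=> _ [x /= x0 <-]; rewrite ler_pdivrMr ?(is_norm_gt0 vnP).
exists (vn (A *m const_mx 1) / vn (const_mx 1)), (const_mx 1) => //=.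
apply/eqP => /matrixP/(_ (Ordinal d_gt0) 0); rewrite !mxE.
by apply/eqP; rewrite oner_neq0.
Qed.

Lemma operator_norm_ge0 A : 0 <= nrm A.
Proof.
have [vn_ge0 _ _ _] := vnP.
by rewrite nrmE; apply: sup_ge0 => _ [x _ <-]; rewrite divr_ge0.
Qed.

Lemma operator_norm0 : nrm 0 = 0.
Proof.
apply/eqP; rewrite eq_le operator_norm_ge0 andbT.
by apply: operator_norm_least => x; rewrite mul0mx (is_norm0 vnP) mul0r.
Qed.

Lemma operator_normM A B : nrm (A *m B) <= nrm A * nrm B.
Proof.
apply: operator_norm_least => x; rewrite -mulmxA -mulrA.
apply: le_trans (operator_norm_apply _ _) _.
by apply: ler_wpM2l; [exact: operator_norm_ge0|exact: operator_norm_apply].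
Qed.

Lemma operator_norm1 : nrm 1%:M <= 1.
Proof. by apply: operator_norm_least => x; rewrite mul1mx mul1r. Qed.

Lemma operator_norm_rprod A a b :
  nrm (rprod A a b) <= \prod_(a <= i < b.+1) nrm (A i).
Proof.
rewrite -(perm_big _ (permEl (perm_rev _))) /rprod /=.
elim/big_rec2 : _ => [|i B y _ yB]; first exact: operator_norm1.
apply: le_trans (operator_normM _ _) _.
by apply: ler_wpM2l => //; exact: operator_norm_ge0.
Qed.

(** In the coordinates y = T^-1 x of an almost Auerbach basis, A acts as
B = T^-1 A T.  As the columns of T are in the unit ball, the norm of A x is at
most the sum of the |(B y)_i|, and each |y_j| is at most twice the norm of x.
Conversely the entry B i j is the i-th coordinate of the image under A of the
j-th column of T, whence |B i j| <= 2 |A|; there are d^2 entries. *)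
Lemma operator_norm_conj : exists2 T : 'M[R[i]]_d, T \in unitmx & forall A,
  nrm A <= 2 * entry_norm cabs (invmx T *m A *m T) /\
  entry_norm cabs (invmx T *m A *m T) <= 2 * d%:R ^+ 2 * nrm A.
Proof.
have [vn_ge0 _ _ _] := vnP.
have [T [Tu T1 vnT]] := almost_auerbach vnP; exists T => // A.
set B := invmx T *m A *m T; split.
  apply: operator_norm_least => x; pose y := invmx T *m x.
  have -> : A *m x = T *m (B *m y).
    by rewrite /B /y !mulmxA mulmxV// mul1mx mulmxK.
  apply: le_trans (is_norm_mulmx_le _ _ vnP) _.
  apply: (@le_trans _ _ (\sum_i \sum_j cabs (B i j) * (2 * vn x))).
    apply: ler_sum => i _; apply: (@le_trans _ _ (cabs ((B *m y) i 0))).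
      by rewrite ler_piMr// absv_ge0.
    rewrite mxE; apply: le_trans (absv_sum _ _ _ _) _; apply: ler_sum => j _.
    by rewrite absvM; apply: ler_wpM2l; [exact: absv_ge0|exact: vnT].
  rewrite [2 * entry_norm _ _]mulrC -mulrA /entry_norm mulr_suml.
  by apply: ler_sum => i _; rewrite mulr_suml.
apply: (@le_trans _ _ (\sum_(i < d) \sum_(j < d) 2 * nrm A)).
  apply: ler_sum => i _; apply: ler_sum => j _.
  have -> : B i j = (invmx T *m (A *m col j T)) i 0.
    by rewrite colE !mulmxA -colE [RHS]mxE.
  apply: le_trans (vnT _ _) _; rewrite ler_pM2l//.
  apply: le_trans (operator_norm_apply _ _) _.
  by rewrite ler_piMr// operator_norm_ge0.
rewrite !sumr_const card_ord -[leLHS]mulr_natr -[X in X * _]mulr_natr.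
by rewrite -mulrA -expr2 mulrAC.
Qed.

End OneNorm.
End OperatorNorm.

(** * Comparison of spectral bounds *)

Section SpectralMax.
Context {R : realType} {k : fieldType} {d : nat}.
Implicit Types (nrm rho : 'M[k]_d -> R) (A : nat -> 'M[k]_d).

Definition spectral_max nrm rho (r : R) n A : R :=
  \big[Num.max/0]_(1 <= a < n.+1) \big[Num.max/0]_(a <= b < n.+1)
    (rho (rprod A a b) / \prod_(a <= i < b.+1) nrm (A i)) `^ r^-1.

Lemma spectral_max_ge0 nrm rho r n A : 0 <= spectral_max nrm rho r n A.
Proof. exact: bigmax_ge_id. Qed.

Lemma spectral_max_le nrm rho r n A M : 0 <= M ->
  (forall a b, (1 <= a <= b)%N -> (b <= n)%N ->
    (rho (rprod A a b) / \prod_(a <= i < b.+1) nrm (A i)) `^ r^-1 <= M) ->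
  spectral_max nrm rho r n A <= M.
Proof.
move=> M_ge0 le_M; rewrite /spectral_max big_nat.
apply: bigmax_le => // a /andP[a1 an]; rewrite big_nat.
by apply: bigmax_le => // b /andP[ab bn]; apply: le_M; rewrite ?a1.
Qed.

Lemma le_spectral_max nrm rho r n A a b : (1 <= a <= b)%N -> (b <= n)%N ->
  (rho (rprod A a b) / \prod_(a <= i < b.+1) nrm (A i)) `^ r^-1
    <= spectral_max nrm rho r n A.
Proof.
move=> /andP[a1 ab] bn; rewrite /spectral_max.
apply: (bigmax_sup_seq _ a); rewrite ?mem_index_iota ?a1//=.
  by rewrite ltnS (leq_trans ab).
by apply: (bigmax_sup_seq _ b); rewrite ?mem_index_iota ?ab.
Qed.

Lemma spectral_max_mono nrm rho r m n A : (m <= n)%N ->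
  spectral_max nrm rho r m A <= spectral_max nrm rho r n A.
Proof.
move=> mn; apply: spectral_max_le => [|a b ab bm].
  exact: spectral_max_ge0.
by apply: le_spectral_max => //; exact: leq_trans mn.
Qed.

Lemma spectral_boundE nrm rho r n A :
  (forall i, (1 <= i <= n)%N -> A i != 0) ->
  spectral_bound nrm rho r n A =
  \prod_(1 <= i < n.+1) nrm (A i) * spectral_max nrm rho r n A.
Proof.
move=> A0; rewrite /spectral_bound; case: hasP => // -[j].
by rewrite mem_index_iota ltnS => /A0/negPf ->.
Qed.

End SpectralMax.

(** Each of the at most n factors of a denominator changes by a factor at most
c, which enters with the exponent 1 / r; each of the n factors of the product in
front of the maximum changes by a factor at most K. *)
Lemma spectral_max_equiv (R : realType) (k : fieldType) d
    (nrm nrm' rho : 'M[k]_d -> R) (r c K : R) n (A B : nat -> 'M[k]_d) :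
  0 < r -> 1 <= c -> 0 <= K -> (forall X, 0 <= rho X) ->
  (forall i, (1 <= i <= n)%N -> 0 < nrm (A i)) ->
  (forall i, (1 <= i <= n)%N -> nrm (A i) <= c * nrm' (B i)) ->
  (forall i, (1 <= i <= n)%N -> nrm' (B i) <= K * nrm (A i)) ->
  (forall a b, rho (rprod B a b) = rho (rprod A a b)) ->
  \prod_(1 <= i < n.+1) nrm' (B i) * spectral_max nrm' rho r n B <=
  K ^+ n * (c ^+ n) `^ r^-1 *
    (\prod_(1 <= i < n.+1) nrm (A i) * spectral_max nrm rho r n A).
Proof.
move=> r_gt0 c_ge1 K_ge0 rho_ge0 A_gt0 AB BA rhoE.
have c_gt0 : 0 < c := lt_le_trans ltr01 c_ge1.
have B_gt0 i : (1 <= i <= n)%N -> 0 < nrm' (B i).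
  by move=> iP; rewrite -(pmulr_rgt0 _ c_gt0);
    exact: lt_le_trans (A_gt0 _ iP) (AB _ iP).
rewrite mulrACA; apply: ler_pM; last 1 first.
- apply: spectral_max_le => [|a b ab bn].
    by rewrite mulr_ge0 ?powR_ge0 ?spectral_max_ge0.
  have inP i : (a <= i < b.+1)%N -> (1 <= i <= n)%N by lia.
  have prodA_gt0 : 0 < \prod_(a <= i < b.+1) nrm (A i).
    by rewrite big_nat prodr_gt0// => i /inP/A_gt0.
  have prodB_gt0 : 0 < \prod_(a <= i < b.+1) nrm' (B i).
    by rewrite big_nat prodr_gt0// => i /inP/B_gt0.
  have prodAB : \prod_(a <= i < b.+1) nrm (A i) <=
      c ^+ n * \prod_(a <= i < b.+1) nrm' (B i).
    apply: (@le_trans _ _ (\prod_(a <= i < b.+1) (c * nrm' (B i)))).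
      rewrite big_nat [leRHS]big_nat; apply: ler_prod => i /inP iP.
      by rewrite ltW ?A_gt0// AB.
    rewrite big_split /= ler_pM2r// prodr_const_nat ler_weXn2l//; lia.
  apply: le_trans (ler_wpM2l (powR_ge0 _ _) (le_spectral_max _ _ _ _ ab bn)).
  rewrite -powRM ?exprn_ge0 ?divr_ge0 ?(ltW c_gt0)//; last exact: ltW.
  apply: ge0_ler_powR; rewrite ?nnegrE ?invr_ge0 ?(ltW r_gt0)//.
  - by rewrite divr_ge0// ltW.
  - by rewrite mulr_ge0 ?exprn_ge0 ?divr_ge0 ?(ltW c_gt0)// ltW.
  rewrite rhoE mulrCA; apply: ler_wpM2l => //.
  by rewrite ler_pdivlMr// mulrC ler_pdivrMr.
- by rewrite big_nat prodr_ge0// => i iP; rewrite ltW ?B_gt0.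
- exact: spectral_max_ge0.
rewrite -[n in K ^+ n](@subn1 n.+1) -prodr_const_nat -big_split /=.
rewrite big_nat [leRHS]big_nat; apply: ler_prod => i iP.
by rewrite ltW ?B_gt0// BA.
Qed.

(** * The uniform inequality *)

Theorem proposition4p2 (R : realType) (d : nat) (hd : (1 <= d)%N)
    (N : nat) (r : R) (hNr : admissible_constants d N r) :
  exists C : R, 1 < C /\
  forall (n : nat) (nrm : 'M[R[i]]_d -> R) (A : nat -> 'M[R[i]]_d),
  (N <= n)%N -> operator_norm (complex_absv R) nrm ->
  nrm (rprod A 1 n) <=
    C * spectral_bound nrm (spectral_radius (complex_absv R)) r n A.
Proof.
case: hNr => _ _ r_gt0 _ hloc.
set cabs := complex_absv R; set rho := spectral_radius cabs.
have [C' [C'_gt1 C'P]] : exists C' : R, 1 < C' /\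
    forall (n : nat) (B : nat -> 'M[R[i]]_d), (N <= n)%N ->
    entry_norm cabs (rprod B 1 n) <=
      C' * spectral_bound (entry_norm cabs (d := d)) rho r n B.
  have [C' [C'_gt1 C'P]] := hloc _ cabs (local_field_complex (R := R))
    R[i] idfun cabs (fun x => algebraic_id idfun x) (fun=> erefl) _
    (entry_norm_submult cabs d).
  exists C'; split=> [//|n B Nn].
  apply: (le_trans (C'P n B Nn)).
  set rho' := fun _ => _; suff -> : rho' = rho by [].
  by apply/funext => X; rewrite /rho' map_mx_id.
pose K : R := 2 * d%:R ^+ 2.
have K_gt0 : 0 < K by rewrite mulr_gt0// exprn_gt0// ltr0n.
pose D := K ^+ N * (2 ^+ N) `^ r^-1.
have D_gt0 : 0 < D by rewrite mulr_gt0 ?exprn_gt0 ?powR_gt0 ?exprn_gt0.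
have C'_gt0 : 0 < C' := lt_trans ltr01 C'_gt1.
have CD_gt0 : 0 < 2 * C' * D by rewrite mulr_gt0// mulr_gt0.
(* C' is the constant for the entry norm, the 2 compares the norms of the
   product, and D accounts for the N factors; 1 is added to exceed 1. *)
exists (1 + 2 * C' * D); split=> [|n nrm A Nn [vn [vnP nrmE]]].
  by rewrite ltrDl.
have [/hasP[j]|/hasPn A0] :=
  boolP (has (fun i => A i == 0) (index_iota 1 n.+1)).
  rewrite mem_index_iota => jn /eqP Aj0.
  rewrite (rprod_eq0 jn Aj0) (operator_norm0 hd vnP nrmE).
  rewrite /spectral_bound; case: hasP => [_|[]]; first by rewrite mulr0.
  by exists j; rewrite ?mem_index_iota ?Aj0.
have {}A0 i : (1 <= i <= n)%N -> A i != 0.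
  by move=> iP; apply: A0; rewrite mem_index_iota.
have [T Tu TP] := operator_norm_conj hd vnP nrmE.
pose B i := invmx T *m A i *m T.
have B0 i : (1 <= i <= n)%N -> B i != 0.
  move=> /A0; apply: contra => /eqP Bi0; apply/eqP.
  rewrite -[A i](mulKVmx Tu) -[invmx T *m _](mulmxK Tu) -/(B i) Bi0.
  by rewrite mul0mx mulmx0.
have A_gt0 i : (1 <= i <= n)%N -> 0 < nrm (A i).
  move=> /B0 Bi0; rewrite -(pmulr_rgt0 _ K_gt0); apply: lt_le_trans (TP _).2.
  exact: (is_norm_gt0 (entry_norm_submult cabs d).1).
rewrite (spectral_boundE _ _ _ A0).
set M := \prod_(1 <= i < n.+1) nrm (A i) * _; have M_ge0 : 0 <= M.
  apply: mulr_ge0; last exact: spectral_max_ge0.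
  by rewrite big_nat prodr_ge0// => i /A_gt0/ltW.
suff main : nrm (rprod A 1 n) <= 2 * C' * D * M.
  by apply: le_trans main _; rewrite ler_wpM2r// lerDr.
(* The first N factors are treated by comparison, the others by
   submultiplicativity. *)
rewrite (rprod_cat A (b := N))//.
apply: le_trans (operator_normM hd vnP nrmE _ _) _.
have firstN : nrm (rprod A 1 N) <= 2 * C' * D *
    (\prod_(1 <= i < N.+1) nrm (A i) * spectral_max nrm rho r N A).
  apply: le_trans (TP _).1 _; rewrite -rprod_conj// -/B -2!mulrA ler_pM2l//.
  apply: le_trans (C'P _ _ (leqnn N)) _; rewrite ler_pM2l//.
  have leN i : (1 <= i <= N)%N -> (1 <= i <= n)%N.
    by move=> /andP[-> /leq_trans->].
  rewrite spectral_boundE => [|i /leN/B0//].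
  apply: spectral_max_equiv.
  - exact: r_gt0.
  - exact: ler1n.
  - exact: ltW.
  - exact: spectral_radius_ge0.
  - by move=> i /leN/A_gt0.
  - by move=> i _; exact: (TP _).1.
  - by move=> i _; exact: (TP _).2.
  - move=> a b; rewrite (rprod_conj A a b Tu).
    exact: (spectral_radius_conj cabs _ Tu).
have prod_ge0 a b : 0 <= \prod_(a <= i < b.+1) nrm (A i).
  by rewrite prodr_ge0// => i _; exact: (operator_norm_ge0 vnP nrmE).
apply: (@le_trans _ _ (\prod_(N.+1 <= i < n.+1) nrm (A i) *
    (2 * C' * D *
      (\prod_(1 <= i < N.+1) nrm (A i) * spectral_max nrm rho r n A)))).
  apply: ler_pM; rewrite ?(operator_norm_ge0 vnP nrmE)//.
    exact: (operator_norm_rprod hd vnP nrmE).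
  apply: le_trans firstN _; rewrite ler_pM2l// ler_wpM2l ?prod_ge0//.
  exact: spectral_max_mono.
rewrite mulrCA ler_pM2l// mulrA [_ * \prod_(1 <= i < _) _]mulrC.
by rewrite -big_cat_nat.
Qed.
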